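(* Let $a>b>0$ be coprime integers with $a-b$ odd, $s=a/b$, $c=\frac{s^4-6s^2+1}{(1+s^2)^2}$ and $A=2-4c^2$. Let $C_A\colon w^2=\lambda^8+A\lambda^4+1$, let $E_A$ be the elliptic curve $y^2=(x+A)(x-2)(x+2)$ over $\mathbb{Q}$, and let $f$ be the rational function on $E_A$ given by $$f(P)=\frac{2y(P)}{(x(P)-2)(x(P)+2)}.$$ Then $C_A$ has a non-degenerate rational point if and only if there exists $P\in E_A(\mathbb{Q})$ (at which $f$ is defined) such that $f(P)$ is a perfect square in $\mathbb{Q}^*$ with $f(P)\neq 1$.
   Context: A non-degenerate rational point on $C_A$ is an affine point $(\lambda,w)\in\mathbb{Q}^2$ satisfying $w^2=\lambda^8+A\lambda^4+1$ with $\lambda\notin\{0,1,-1\}$. ''Perfect square in $\mathbb{Q}^*$'' means an element of $\mathbb{Q}^{*2}=\{q^2: q\in\mathbb{Q}^*\}$. *)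

(* Defs.v *)
From HB Require Import structures.
From mathcomp Require Import all_boot all_order all_algebra.

Set Implicit Arguments.
Unset Strict Implicit.
Unset Printing Implicit Defensive.

Import Order.TTheory GRing.Theory Num.Theory.

Local Open Scope ring_scope.

(* Q-points of the affine curve C_A : w^2 = lambda^8 + A lambda^4 + 1. *)
Definition on_C (A : rat) (p : rat * rat) : Prop :=
  p.2 ^+ 2 = p.1 ^+ 8 + A * p.1 ^+ 4 + 1.

Definition nondegenerate_pt (p : rat * rat) : Prop :=
  [/\ p.1 <> 0, p.1 <> 1 & p.1 <> -1].

(* A plane projective curve in Weierstrass form meets the line at infinity
   only in [0 : 1 : 0]. *)
Inductive point : Type :=
  | Infinity
  | Affine of rat & rat.

Definition on_E (A : rat) (P : point) : Prop :=
  match P with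
  | Infinity => True
  | Affine x y => y ^+ 2 = (x + A) * (x - 2) * (x + 2)
  end.

(* The value at P of the rational function f = 2y / ((x - 2)(x + 2)) on E_A,
   with None at its poles.  At infinity y has a pole of order 3 and x one of
   order 2, so f is regular there with value 0.  At an affine point where the
   denominator vanishes, i.e. at (2, 0) and (-2, 0), f really has a pole when
   A is neither 2 nor -2 (E_A smooth): there f = 2(x + A) / y on E_A, with
   x + A nonzero and y = 0. *)
Definition f_val (P : point) : option rat :=
  match P with
  | Infinity => Some 0
  | Affine x y =>
      if (x - 2) * (x + 2) == 0 then None
      else Some (2 * y / ((x - 2) * (x + 2)))
  end.

Definition nonzero_square (v : rat) : Prop :=
  exists q : rat, q <> 0 /\ v = q ^+ 2.

(* Main.v *)
(* If f(P) = lambda^2 with P = (x, y) on E_A, squaring gives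
   lambda^4 (x^2 - 4) = 4 (x + A), a quadratic equation in x whose discriminant
   is 16 (lambda^8 + A lambda^4 + 1).  A rational x thus corresponds to a
   rational w = (lambda^4 x - 2) / 2 on C_A.  Conversely x = 2 (w + 1) / lambda^4
   and y = lambda^2 (x^2 - 4) / 2; such an x with x^2 = 4 would equal -A, so it
   is enough that A is neither 2 (i.e. c <> 0, by parity) nor -2 (i.e. c <> 1
   and c <> -1, as s > 1). *)
Require Import Defs.
From mathcomp Require Import all_boot all_order all_algebra.
From mathcomp Require Import ring lra.

Import Order.TTheory GRing.Theory Num.Theory.
Local Open Scope ring_scope.

Lemma C_point_of_E_point (A : rat) (P : point) (v : rat) :
  on_E A P -> f_val P = Some v -> nonzero_square v -> v <> 1 ->
  exists p : rat * rat, on_C A p /\ nondegenerate_pt p.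
Proof.
move=> hE hf [q [q0 vq]] v1; subst v.
case: P hE hf => [_ [/esym/eqP]|x y /= hE]; first by rewrite sqrf_eq0 => /eqP.
case: eqP => // /eqP d0 [hq].
have hy : 2 * y = q ^+ 2 * ((x - 2) * (x + 2)) by rewrite -hq divfK.
have hx : 4 * (x + A) = q ^+ 4 * ((x - 2) * (x + 2)).
  (* Squaring [hy] and using the equation of the curve gives the claim multiplied by the nonzero
     factor [(x - 2) * (x + 2)]. *)
  apply: (mulIf d0).
  have -> : 4 * (x + A) * ((x - 2) * (x + 2)) = (2 * y) ^+ 2.
    by rewrite exprMn hE; ring.
  by rewrite hy; ring.
exists (q, (q ^+ 4 * x - 2) / 2); split; last first.
  by split=> //= q1; apply: v1; rewrite q1 ?sqrrN expr1n.
rewrite /on_C /=.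
(* With [A] eliminated, the equation of the curve is an identity in [q] and [x]. *)
have -> : A = q ^+ 4 * ((x - 2) * (x + 2)) / 4 - x by rewrite -hx; field.
by field.
Qed.

Lemma E_point_of_C_point (A : rat) (p : rat * rat) :
  A != 2 -> A != - 2 -> on_C A p -> nondegenerate_pt p ->
  exists P : point, on_E A P /\
    exists v : rat, [/\ f_val P = Some v, nonzero_square v & v <> 1].
Proof.
case: p => l w A2 Am2; rewrite /on_C /= => hC [/= /eqP l0 l1 lm1].
pose x := 2 * (w + 1) / l ^+ 4.
have hx : 4 * (x + A) = l ^+ 4 * ((x - 2) * (x + 2)).
  apply: (mulIf (expf_neq0 4 l0)).
  have hxl : x * l ^+ 4 = 2 * (w + 1) by rewrite /x divfK // expf_neq0.
  (* After multiplication by [l ^+ 4], both sides equal [4 * (w + 1) ^+ 2 - 4 * l ^+ 8]. *)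
  transitivity (4 * (x * l ^+ 4) + 4 * (A * l ^+ 4)); first by ring.
  transitivity ((x * l ^+ 4) ^+ 2 - 4 * l ^+ 8); last by ring.
  have -> : A * l ^+ 4 = w ^+ 2 - l ^+ 8 - 1 by rewrite hC; ring.
  by rewrite hxl; ring.
have d0 : (x - 2) * (x + 2) != 0.
  apply/eqP => d0; move: hx; rewrite d0 mulr0 => /eqP.
  rewrite mulf_eq0 /= => /eqP hxA.
  have xA : x = - A by lra.
  move/eqP: d0; rewrite xA mulf_eq0 => /orP[] /eqP h.
    by move/eqP: Am2; apply; lra.
  by move/eqP: A2; apply; lra.
exists (Affine x (l ^+ 2 * ((x - 2) * (x + 2)) / 2)); split.
  rewrite /on_E.
  have -> : x + A = l ^+ 4 * ((x - 2) * (x + 2)) / 4 by rewrite -hx; field.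
  by field.
exists (l ^+ 2); split.
- rewrite /f_val (negbTE d0); congr Some.
  by apply: (mulIf d0); rewrite divfK //; field.
- by exists l; split=> //; apply/eqP.
- by move/eqP; rewrite sqrf_eq1 => /orP[] /eqP.
Qed.

(** Modulo 2 the form is congruent to [(a - b) ^+ 4], which is odd. *)
Lemma quartic_form_neq0 (a b : int) : odd `|a - b|%N ->
  a ^+ 4 - 6 * (a ^+ 2 * b ^+ 2) + b ^+ 4 != 0.
Proof.
move=> hodd; apply/eqP => h.
have : (2 %| (a - b) ^+ 4)%Z.
  (* The witness is half the difference between [(a - b) ^+ 4] and the form, assumed zero. *)
  apply/dvdzP; exists (6 * (a ^+ 2 * b ^+ 2) - 2 * (a ^+ 3 * b + a * b ^+ 3)).
  by rewrite -[LHS]subr0 -h; ring.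
by rewrite dvdzE abszX dvdn2 oddX hodd.
Qed.

Theorem corollary5p2 (a b : int) (hb : 0 < b) (hab : b < a)
    (hcop : coprimez a b) (hodd : odd `|a - b|%N) :
  let s : rat := a%:~R / b%:~R in
  let c : rat := (s ^+ 4 - 6 * s ^+ 2 + 1) / (1 + s ^+ 2) ^+ 2 in
  let A : rat := 2 - 4 * c ^+ 2 in
  (exists p : rat * rat, on_C A p /\ nondegenerate_pt p) <->
  (exists P : point, on_E A P /\
     exists v : rat, [/\ f_val P = Some v, nonzero_square v & v <> 1]).
Proof.
move=> s c A; split; last first.
  by move=> [P [hE [v [hf hv v1]]]]; apply: C_point_of_E_point hE hf hv v1.
move=> [p [hC hp]].
have b0 : (b%:~R : rat) != 0 by rewrite intr_eq0 gt_eqF.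
have s1 : 1 < s by rewrite /s ltr_pdivlMr ?ltr0z // mul1r ltr_int.
have s2 : 1 < s ^+ 2 by rewrite exprn_egt1.
have D0 : (1 + s ^+ 2) ^+ 2 != 0.
  by rewrite expf_neq0 // gt_eqF // ltr_wpDr ?sqr_ge0.
have cD : c * (1 + s ^+ 2) ^+ 2 = s ^+ 4 - 6 * s ^+ 2 + 1 by rewrite divfK.
apply: E_point_of_C_point hC hp.
- apply/eqP => A2.
  have /eqP : c ^+ 2 = 0 by rewrite /A in A2; lra.
  rewrite sqrf_eq0 => /eqP c0; move: cD; rewrite c0 mul0r => h.
  have /eqP := quartic_form_neq0 a b hodd; apply.
  (* Multiplying the numerator of [c] by [b ^+ 4] gives the quartic form in [a] and [b]. *)
  apply: (@intr_inj rat).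
  transitivity ((s ^+ 4 - 6 * s ^+ 2 + 1) * b%:~R ^+ 4); last by rewrite -h mul0r.
  by rewrite /s; field.
- apply/eqP => A2; move: s2; rewrite ltNge => /negP; apply.
  have /eqP : c ^+ 2 = 1 by rewrite /A in A2; lra.
  (* Here [c = 1] forces [8 * s ^+ 2 = 0], while [c = -1] forces [2 * (s ^+ 2 - 1) ^+ 2 = 0]. *)
  rewrite sqrf_eq1 => /orP[] /eqP c1; move: cD; rewrite c1 => h; first by lra.
  have /eqP : (s ^+ 2 - 1) ^+ 2 = 0 by lra.
  by rewrite sqrf_eq0 => /eqP; lra.
Qed.
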